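(* Suppose $\Theta\subseteq\mathbb R^d$ for some $d\ge 1$, $\theta^0$ is an interior point of $\Theta$, and there is a neighborhood of $\theta^0$ on which, for every $n$, $\theta\mapsto L_n(\theta;Y)$ is $\mathsf P$-almost surely differentiable. Suppose further that for all small enough $\varepsilon>0$ there are a finite number $s$ (not depending on $n$), subsets $A_i=A_i(\varepsilon)\subseteq\bar B_\varepsilon(\theta^0)$ and corresponding subcollections $W^{(i)}$ of $Y$ with $m_i=m_i(n)$ components, $i=1,\dots,s$, such that $\bigcup_{i=1}^s A_i\supseteq\bar B_\varepsilon(\theta^0)\cap B_\varepsilon(\theta^0)^c$ and the following three conditions hold. (1) Each $A_i$ is identified by $W^{(i)}$ with some identification rate $a_{n,i}$, $n=1,2,\dots$, $i=1,\dots,s$. (2) For every $i\in\{1,\dots,s\}$ and $n\in\{1,2,\dots\}$ there exists a random variable $K_{n,i}$ not depending on $\theta$ such that, $\mathsf{P}$-almost surely and for every $\theta,\theta'\in A_i$, $|\Lambda_n(\theta;Y)-\Lambda_n(\theta';Y)|\le K_{n,i}\,\|\theta-\theta'\|$. (3) Each $A_i$ can be covered by $M_{n,i}$ balls of radius $\delta_{n,i}$ such that, as $n\to\infty$, $K_{n,i}\delta_{n,i}\to 0$ in probability and $M_{n,i}a_{n,i}\to 0$. Then, for all small enough $\varepsilon>0$, with probability tending to one as $n\to\infty$ there exists a local maximizer of $\theta\mapsto L_n(\theta;Y)$, and hence a root to the likelihood equation $\nabla\Lambda_n(\theta;Y)=0$, in $B_\varepsilon(\theta^0)$.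
   Context: For each $n$, $Y=(Y_1,\dots,Y_n)$ is a collection of random variables on a probability space $(\Omega,\mathcal F,\mathsf P)$ (triangular arrays are allowed: the components may depend on $n$). The parameter set $\Theta\subseteq\mathbb R^d$ carries the Euclidean metric; $B_\delta(t)=\{t'\in\mathbb R^d:\|t-t'\|<\delta\}$, $\bar B_\delta(t)$ is its closure, $A^c$ denotes complement, and $\nabla$ is the gradient with respect to $\theta$. For $\theta\in\Theta$, $f^n_\theta$ is a joint density for $Y$ against a dominating $\sigma$-finite product measure $\nu=\nu_n$, and may depend on $n$ in an arbitrary manner. The true parameter $\theta^0\in\Theta$ is the same for all $n$, meaning $\mathsf P(Y\in A)=\int_A f^n_{\theta^0}(y)\,\nu(dy)$ for all measurable $A$. Set $L_n(\theta;Y)=f^n_\theta(Y)/f^n_{\theta^0}(Y)$ and $\Lambda_n(\theta;Y)=\log L_n(\theta;Y)$. A subcollection $W=(W_1,\dots,W_m)$ of $Y$ is a collection of random variables with $\{W_1,\dots,W_m\}\subseteq\{Y_1,\dots,Y_n\}$, where $m=m(n)\to\infty$ as $n\to\infty$. Its joint density under $\theta$ (the corresponding marginal of $f^n_\theta$) is $g^m_\theta$, and $L_m(\theta;W)=g^m_\theta(W)/g^m_{\theta^0}(W)$. A subset $A\subseteq\Theta$ is identified by $W$ if $\sup_{\theta\in A}L_m(\theta;W)\to 0$ in $\mathsf P$-probability as $n\to\infty$. If $\sup_{\theta\in A}L_m(\theta;W)=O_{\mathsf P}(a_n)$ for a sequence of constants $\{a_n\}$, $a_n$ is called an identification rate.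 *)

(* Defs.v *)
From HB Require Import structures.
From mathcomp Require Import all_boot all_order all_algebra.
From mathcomp Require Import all_classical all_reals all_analysis.

Set Implicit Arguments.
Unset Strict Implicit.
Unset Printing Implicit Defensive.

Import Order.TTheory GRing.Theory Num.Theory.
Import numFieldNormedType.Exports.

Local Open Scope classical_set_scope.
Local Open Scope ring_scope.

Section product_measure.
Context {d : measure_display} {T : measurableType d} {R : realType}.

Definition tcons n (p : T * n.-tuple T) : n.+1.-tuple T := [tuple of p.1 :: p.2].

Lemma measurable_tcons n : measurable_fun [set: T * n.-tuple T] (@tcons n).
Proof. exact: measurable_cons. Qed.

Section one_more_factor.
Variables (n : nat) (m1 : {sigma_finite_measure set T -> \bar R}).
Variable m2 : {sigma_finite_measure set (n.-tuple T) -> \bar R}.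

Definition tcons_measure : set (n.+1.-tuple T) -> \bar R :=
  pushforward (m1 \x m2)%E (@tcons n).

Let tcons_preimage A : measurable A -> measurable (@tcons n @^-1` A).
Proof. by move=> mA; rewrite -[X in measurable X]setTI; exact: measurable_tcons. Qed.

Let tcons_measure0 : tcons_measure set0 = 0%E.
Proof. by rewrite /tcons_measure /pushforward preimage_set0 measure0. Qed.

Let tcons_measure_ge0 A : (0 <= tcons_measure A)%E.
Proof. by rewrite /tcons_measure /pushforward. Qed.

Let tcons_measure_sigma_additive : semi_sigma_additive tcons_measure.
Proof.
move=> F mF tF mUF; rewrite /tcons_measure /pushforward preimage_bigcup.
apply: measure_semi_sigma_additive; first by move=> k; exact: tcons_preimage.
- apply/trivIsetP => /= i j _ _ ij; rewrite -preimage_setI.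
  by move/trivIsetP : tF => /(_ _ _ _ _ ij) ->//; rewrite preimage_set0.
- by rewrite -preimage_bigcup; exact: tcons_preimage.
Qed.

HB.instance Definition _ := isMeasure.Build _ _ _ tcons_measure
  tcons_measure0 tcons_measure_ge0 tcons_measure_sigma_additive.

Let tcons_measure_sigma_finite : sigma_finite [set: n.+1.-tuple T] tcons_measure.
Proof.
have /sigma_finiteP[F [TF ndF Foo]] := sigma_finiteT m1.
have /sigma_finiteP[G [TG ndG Goo]] := sigma_finiteT m2.
pose th (t : n.+1.-tuple T) := thead t.
pose bh (t : n.+1.-tuple T) : n.-tuple T := [tuple of behead t].
have mth : measurable_fun [set: n.+1.-tuple T] th by exact: measurable_tnth.
have mbh : measurable_fun [set: n.+1.-tuple T] bh by exact: measurable_behead.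
exists (fun k => th @^-1` F k `&` bh @^-1` G k).
  rewrite predeqE => t; split=> // _.
  have [k _ Fk] : (\bigcup_k F k) (th t) by rewrite -TF.
  have [l _ Gl] : (\bigcup_k G k) (bh t) by rewrite -TG.
  exists (maxn k l) => //; split.
  - by have /subsetPset FF := ndF _ _ (leq_maxl k l); exact: FF.
  - by have /subsetPset GG := ndG _ _ (leq_maxr k l); exact: GG.
move=> k; have [mF Fk] := Foo k; have [mG Gk] := Goo k; split.
  apply: measurableI; rewrite -[X in measurable X]setTI.
  - exact: mth.
  - exact: mbh.
rewrite /tcons_measure /pushforward.
rewrite (_ : _ @^-1` _ = F k `*` G k); last first.
  rewrite predeqE => -[x t] /=; rewrite /th theadE.
  by rewrite (_ : bh _ = t)//; exact: val_inj.
by rewrite product_measure1E// lte_mul_pinfty// ge0_fin_numE.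
Qed.

HB.instance Definition _ :=
  Measure_isSigmaFinite.Build _ _ _ tcons_measure tcons_measure_sigma_finite.

End one_more_factor.

Fixpoint tuple_measure n :
    ('I_n -> {sigma_finite_measure set T -> \bar R}) ->
    {sigma_finite_measure set (n.-tuple T) -> \bar R} :=
  match n with
  | 0 => fun=> (\d_([tuple] : 0.-tuple T) : {sigma_finite_measure set _ -> \bar R})
  | n'.+1 => fun mu =>
      (tcons_measure (mu ord0) (tuple_measure (fun i => mu (lift ord0 i)))
        : {sigma_finite_measure set _ -> \bar R})
  end.

Lemma tuple_measure_box n (mu : 'I_n -> {sigma_finite_measure set T -> \bar R})
    (A : 'I_n -> set T) : (forall i, measurable (A i)) ->
  tuple_measure mu [set t | forall i, A i (tnth t i)] =
    (\prod_(i < n) mu i (A i))%E.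
Proof.
elim: n mu A => [|n IHn] mu A mA.
  rewrite big_ord0 /= (_ : mkset _ = setT) ?diracT//.
  by rewrite predeqE => t; split=> // _ [].
rewrite big_ord_recl -(IHn _ (fun i => A (lift ord0 i)))//.
rewrite /= /tcons_measure /pushforward.
set B := [set t : n.-tuple T | _].
have mB : measurable B.
  rewrite (_ : B = \bigcap_(i in [set: 'I_n])
      ((fun t : n.-tuple T => tnth t i) @^-1` A (lift ord0 i))); last first.
    by rewrite predeqE => t; split=> [Bt i _|Bt i]; [exact: Bt|exact: (Bt i)].
  apply: fin_bigcap_measurable => // i _.
  by rewrite -[X in measurable X]setTI; exact: measurable_tnth.
rewrite -product_measure1E//; congr (product_measure1 _ _ _).
rewrite predeqE => -[x t] /=; split=> [AB|[Ax Bt] i].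
  by split=> [|i]; [exact: (AB ord0)|have := AB (lift ord0 i); rewrite tnthS].
by case: (unliftP ord0 i) => [j|] -> //; rewrite tnthS; exact: Bt.
Qed.

End product_measure.

Section euclidean.
Context {R : realType} {d : nat}.
Implicit Types (x t : 'rV[R]_d) (e : R).

(* The library norm on row vectors is the max-norm. *)
Definition enorm x : R := Num.sqrt (\sum_(j < d) x ord0 j ^+ 2).

Definition eball t e : set 'rV[R]_d := [set t' | enorm (t - t') < e].

Definition gradient (h : 'rV[R]_d -> R) x : 'rV[R]_d :=
  \row_(j < d) 'D_(delta_mx ord0 j) h x.

Definition local_maximizer (D : set 'rV[R]_d) (h : 'rV[R]_d -> R) x :=
  D x /\ \forall t \near within D (nbhs x), h t <= h x.

End euclidean.

Section subcollections.
Context {R : realType} {n : nat}.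
Implicit Type S : {set 'I_n}.

(* A subcollection with m components is given by the set [S] of its indices,
   m = #|S|; its components are listed in increasing order of the index. *)
Definition subtuple S (y : n.-tuple R) : #|S|.-tuple R :=
  [tuple tnth y (enum_val k) | k < #|S|].

Definition merge S (w : #|S|.-tuple R) (z : #|~: S|.-tuple R) : n.-tuple R :=
  [tuple if j \in S then nth 0 w (index j (enum S))
         else nth 0 z (index j (enum (~: S))) | j < n].

Lemma merge_subtuple S (y : n.-tuple R) :
  merge (subtuple S y) (subtuple (~: S) y) = y.
Proof.
have nthE (A : {set 'I_n}) j : j \in A ->
    nth 0 (subtuple A y) (index j (enum A)) = tnth y j.
  move=> jA; have jlt : (index j (enum A) < #|A|)%N.
    by rewrite cardE index_mem mem_enum.
  rewrite -[index _ _]/(nat_of_ord (Ordinal jlt)) -tnth_nth tnth_mktuple.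
  by rewrite (enum_val_nth j) /= nth_index// mem_enum.
apply: eq_from_tnth => j; rewrite tnth_mktuple.
by case: ifPn => jS; rewrite nthE// finset.in_setC.
Qed.

Definition marginal (nu : 'I_n -> {sigma_finite_measure set R -> \bar R}) S
    (f : n.-tuple R -> R) (w : #|S|.-tuple R) : \bar R :=
  \int[tuple_measure (fun k : 'I_#|~: S| => nu (enum_val k))]_z
    (f (merge w z))%:E.

End subcollections.

Definition is_density {d} {T : measurableType d} {R : realType}
    (nu : {measure set T -> \bar R}) (f : T -> R) :=
  [/\ measurable_fun setT f, forall y, 0 <= f y &
      (\int[nu]_y (f y)%:E = 1)%E].

Section likelihood.
Context {R : realType} {p n : nat}.
Variable nu : 'I_n -> {sigma_finite_measure set R -> \bar R}.
Variable f : 'rV[R]_p -> n.-tuple R -> R.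
Variable theta0 : 'rV[R]_p.

Definition lik (y : n.-tuple R) (theta : 'rV[R]_p) : R :=
  f theta y / f theta0 y.

(* [lne 0 = -oo], unlike [ln 0 = 0]; an inequality
   [`|loglik y t - loglik y t'| <= r%:E] thus forces both terms to be finite. *)
Definition loglik (y : n.-tuple R) (theta : 'rV[R]_p) : \bar R :=
  lne (lik y theta)%:E.

Definition sublik (S : {set 'I_n}) (w : #|S|.-tuple R) (theta : 'rV[R]_p)
    : \bar R :=
  (marginal nu (f theta) w / marginal nu (f theta0) w)%E.

(* The supremum is taken in [0, +oo], so that it is 0 for empty [A]. *)
Definition sup_sublik (A : set 'rV[R]_p) (S : {set 'I_n}) (w : #|S|.-tuple R)
    : \bar R :=
  maxe 0%E (ereal_sup [set sublik w theta | theta in A]).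

(* A root of the likelihood equation is a zero of the gradient of the
   log-likelihood at a point around which the log-likelihood is finite. *)
Definition likelihood_root (y : n.-tuple R) (theta : 'rV[R]_p) :=
  [/\ \forall t \near theta, loglik y t \is a fin_num,
      differentiable (fine \o loglik y) theta &
      gradient (fine \o loglik y) theta = 0].

End likelihood.

(* The outer probability [P^*] agrees with [P] on events; it is used since
   suprema over uncountable sets need not be measurable. *)
Section stochastic_order.
Context {d} {T : measurableType d} {R : realType} (P : probability T R).
Implicit Type X : nat -> T -> \bar R.

Definition cvg_in_probability0 X := forall eta : R, 0 < eta ->
  (P^*)%mu [set w | (eta%:E < `|X n w|)%E] @[n --> \oo] --> 0%E.

Definition bigO_in_probability X (a : nat -> R) := forall eta : R, 0 < eta ->
  exists2 C : R, 0 < C & \forall n \near \oo,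
    ((P^*)%mu [set w | ((C * `|a n|)%:E < `|X n w|)%E] <= eta%:E)%E.

Definition with_probability_tending_to_one (E : nat -> set T) :=
  (P^*)%mu (~` E n) @[n --> \oo] --> 0%E.

End stochastic_order.

Section conditions.
Context {dO : measure_display} {Omega : measurableType dO} {R : realType}.
Context {P : probability Omega R} {p : nat}.
Variable Y : forall n, 'I_n -> {RV P >-> R}.
Variable nu : forall n, 'I_n -> {sigma_finite_measure set R -> \bar R}.
Variable f : forall n, 'rV[R]_p -> n.-tuple R -> R.
Variable theta0 : 'rV[R]_p.

Definition sample n (w : Omega) : n.-tuple R := [tuple Y i w | i < n].

Definition sup_lik_of (A : set 'rV[R]_p) (S : forall n, {set 'I_n}) n (w : Omega)
    : \bar R :=
  sup_sublik (@nu n) (@f n) theta0 A (subtuple (S n) (sample n w)).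

Definition identified A (S : forall n, {set 'I_n}) :=
  cvg_in_probability0 P (sup_lik_of A S).

Definition identification_rate A (S : forall n, {set 'I_n}) (a : nat -> R) :=
  bigO_in_probability P (sup_lik_of A S) a.

Definition lipschitz_loglik (A : set 'rV[R]_p) n (K : {RV P >-> R}) :=
  {ae P, forall w, forall t t', A t -> A t' ->
    (`|loglik (@f n) theta0 (sample n w) t - loglik (@f n) theta0 (sample n w) t'|
      <= (K w * enorm (t - t'))%:E)%E}.

End conditions.

Definition covered_by_balls {R : realType} {p : nat} (A : set 'rV[R]_p)
    (M : nat) (delta : R) :=
  exists c : 'I_M -> 'rV[R]_p, A `<=` \bigcup_k eball (c k) delta.

(* Main.v *)
Require Import Defs.
From mathcomp Require Import all_boot all_order all_algebra.
From mathcomp Require Import all_classical all_reals all_analysis.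
From mathcomp Require Import measurable_realfun ring lra.

Set Implicit Arguments.
Unset Strict Implicit.
Unset Printing Implicit Defensive.

Import Order.TTheory GRing.Theory Num.Theory.
Import numFieldNormedType.Exports.

Local Open Scope classical_set_scope.
Local Open Scope ring_scope.

(** Why the theorem holds.  Almost surely the likelihood ratio [L] equals 1 at
    the true parameter.  If [L < 1] on the whole sphere around it, the maximum
    of the continuous function [L] over the compact closed ball is attained
    inside the open ball; there [L >= 1 > 0], and the gradient of [ln L]
    vanishes by Fermat's rule ([likelihood_root_in_ball]).  So it suffices
    that, on each of the finitely many pieces [A] covering the sphere, [L < 1]
    with probability tending to one.

    Cover [A] by [M] balls of radius [delta] and pick a point of [A] in each
    ball.  Two points of a ball are at distance at most [2 * delta], so the
    Lipschitz bound lets [ln L] vary by at most [2 * |K * delta|] around the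
    chosen point ([lik_lt1_of_lipschitz]).  When [|K * delta| <= 1/2], having
    [L <= exp (-2)] at the [M] chosen points forces [L <= exp (-1) < 1] on
    [A].

    At one chosen point [t], let [g_t] be the density of the subcollection
    [W] under [t].  The conditional expectation of [L t] given [W] is
    [g_t W / g_theta0 W], so a Markov bound on the event that this ratio is at
    most [c] gives
      [P (L t > eta, g_t W / g_theta0 W <= c) <= c / eta]
    ([likelihood_ratio_tail], [lik_tail_bound]).  The only input is that [g_t]
    integrates like [f_t] over events depending on [W] alone
    ([integral_marginal]): a Fubini theorem for the splitting of the
    coordinates into those inside and outside [W], obtained from the fact that
    a product measure is determined by its values on boxes
    ([tuple_measure_unique], [tuple_measure_split]).

    The identification rate provides [C] such that the marginal ratio exceeds
    [c = C * |a_n|] somewhere on [A] with arbitrarily small probability.  For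
    this [c], the union bound over the [M] chosen points costs
    [M * C * |a_n| / exp (-2)], which tends to 0 ([lik_ge1_bound]). *)

(** * Product measures on tuples are determined by boxes *)

Section product_structure.
Context {d : measure_display} {T : measurableType d} {R : realType}.

Definition tuple_box n (A : 'I_n -> set T) : set (n.-tuple T) :=
  [set t | forall i, A i (tnth t i)].

Lemma measurable_tuple_box n (A : 'I_n -> set T) :
  (forall i, measurable (A i)) -> measurable (tuple_box A).
Proof.
move=> mA; rewrite (_ : tuple_box A = \bigcap_(i in [set: 'I_n])
    ((fun t : n.-tuple T => tnth t i) @^-1` A i)); last first.
  by rewrite predeqE => t; split=> [Bt i _|Bt i]; [exact: Bt|exact: (Bt i)].
apply: fin_bigcap_measurable => // i _.
by rewrite -[X in measurable X]setTI; exact: measurable_tnth.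
Qed.

Lemma measurable_tupleE n :
  measurable = <<s [set tuple_box A | A in
                    [set A : 'I_n -> set T | forall i, measurable (A i)]] >>.
Proof.
apply/seteqP; split; last first.
  apply: smallest_sub; first exact: sigma_algebra_measurable.
  by move=> _ [A mA <-]; exact: measurable_tuple_box.
apply: smallest_sub; first exact: smallest_sigma_algebra.
rewrite -bigcup_seq => X [i _ [A mA <-]]; apply: sub_sigma_algebra.
exists (fun j => if j == i then A else setT).
  by move=> j; case: ifP.
rewrite predeqE => t; split=> [/(_ i)|[_ /= At] j]; first by rewrite eqxx.
by case: eqP => // ->.
Qed.

(** Boxes form a pi-system generating the sigma-algebra; the boxes whose sides
    are the [k]-th sets of exhausting sequences of the factors have finite
    measure and cover the whole space. *)
Lemma tuple_measure_unique n (mu : 'I_n -> {sigma_finite_measure set T -> \bar R})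
    (m : {measure set (n.-tuple T) -> \bar R}) :
  (forall A, (forall i, measurable (A i)) ->
     m (tuple_box A) = (\prod_(i < n) mu i (A i))%E) ->
  forall X, measurable X -> tuple_measure mu X = m X.
Proof.
move=> mE.
have /choice[F FP] : forall i, exists F : (set T)^nat,
    [/\ setT = \bigcup_k F k, nondecreasing_seq F &
        forall k, measurable (F k) /\ (mu i (F k) < +oo)%E].
  by move=> i; have /sigma_finiteP[F [? ? ?]] := sigma_finiteT (mu i); exists F.
move=> X mX.
apply: (measure_unique _ (fun k => tuple_box (fun i => F i k))
  (@measurable_tupleE n)) => //.
- move=> _ _ [A mA <-] [B mB <-]; exists (fun i => A i `&` B i).
    by move=> i; exact: measurableI.
  rewrite predeqE => t; split=> [AB|[At Bt] i //].
  by split=> i; have [] := AB i.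
- by move=> k; exists (fun i => F i k) => // i; have [_ _ /(_ k)[]] := FP i.
- rewrite predeqE => t; split=> // _.
  have /choice[k kP] : forall i, exists k, F i k (tnth t i).
    move=> i; have [FT _ _] := FP i.
    by have : [set: T] (tnth t i) by []; rewrite FT => -[k _ ?]; exists k.
  exists (\max_(i < n) k i)%N => // i; have [_ ndF _] := FP i.
  have /subsetPset := ndF _ _ (leq_bigmax i : (k i <= \max_(i < n) k i)%N).
  exact.
- by move=> _ [A mA <-]; rewrite mE//; exact: tuple_measure_box.
- move=> k; rewrite [X in (X < _)%E]tuple_measure_box; last first.
    by move=> i; have [_ _ /(_ k)[]] := FP i.
  rewrite -ge0_fin_numE; last by apply: prode_ge0.
  apply: prode_fin_num => i _; rewrite ge0_fin_numE//.
  by have [_ _ /(_ k)[]] := FP i.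
Qed.

End product_structure.

(** * Splitting the coordinates *)

Section splitting.
Context {R : realType} {n : nat}.
Implicit Type S : {set 'I_n}.

Lemma tnth_merge_in S (w : #|S|.-tuple R) (z : #|~: S|.-tuple R) (k : 'I_#|S|) :
  tnth (Defs.merge w z) (enum_val k) = tnth w k.
Proof.
rewrite tnth_mktuple enum_valP (tnth_nth 0).
by rewrite {1}/enum_val index_uniq ?enum_uniq// -cardE.
Qed.

Lemma tnth_merge_out S (w : #|S|.-tuple R) (z : #|~: S|.-tuple R)
  (k : 'I_#|~: S|) : tnth (Defs.merge w z) (enum_val k) = tnth z k.
Proof.
rewrite tnth_mktuple; have := enum_valP k; rewrite finset.in_setC => /negbTE ->.
rewrite (tnth_nth 0).
by rewrite {1}/enum_val index_uniq ?enum_uniq// -cardE.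
Qed.

Lemma subtuple_merge S (w : #|S|.-tuple R) (z : #|~: S|.-tuple R) :
  subtuple S (Defs.merge w z) = w.
Proof. by apply: eq_from_tnth => k; rewrite tnth_mktuple tnth_merge_in. Qed.

Lemma measurable_subtuple S : measurable_fun setT (subtuple S : n.-tuple R -> _).
Proof.
apply/measurable_fun_tnthP => k.
rewrite (_ : _ \o _ = (fun y : n.-tuple R => tnth y (enum_val k))).
  exact: measurable_tnth.
by apply/funext => y /=; rewrite tnth_mktuple.
Qed.

Definition merge_pair S (p : #|S|.-tuple R * #|~: S|.-tuple R) : n.-tuple R :=
  Defs.merge p.1 p.2.

Lemma ord_in_or_out S j :
  (exists k : 'I_#|S|, j = enum_val k) \/ (exists k : 'I_#|~: S|, j = enum_val k).
Proof.
have [jS|jS] := boolP (j \in S).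
  by left; exists (enum_rank_in jS j); rewrite enum_rankK_in.
have {}jS : j \in ~: S by rewrite finset.in_setC.
by right; exists (enum_rank_in jS j); rewrite enum_rankK_in.
Qed.

Lemma measurable_merge_pair S : measurable_fun setT (@merge_pair S).
Proof.
apply/measurable_fun_tnthP => j.
have [[k ->]|[k ->]] := ord_in_or_out S j.
  rewrite (_ : _ \o _ = (fun w => tnth w k) \o fst).
    by apply: measurableT_comp => //; exact: measurable_tnth.
  by apply/funext => -[w z] /=; rewrite tnth_merge_in.
rewrite (_ : _ \o _ = (fun z => tnth z k) \o snd).
  by apply: measurableT_comp => //; exact: measurable_tnth.
by apply/funext => -[w z] /=; rewrite tnth_merge_out.
Qed.

Variable nu : 'I_n -> {sigma_finite_measure set R -> \bar R}.

Definition sub_measure S : {sigma_finite_measure set (#|S|.-tuple R) -> \bar R} :=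
  tuple_measure (fun k : 'I_#|S| => nu (enum_val k)).

(** The box with sides [A] pulls back under merging to the product of the boxes
    with the sides of index in, respectively outside, [S]. *)
Lemma tuple_measure_split S (X : set (n.-tuple R)) : measurable X ->
  tuple_measure nu X =
  pushforward (sub_measure S \x sub_measure (~: S))%E (@merge_pair S) X.
Proof.
move=> mX.
apply: tuple_measure_unique => //; first exact: measurable_merge_pair.
move=> mS A mA.
transitivity ((sub_measure S \x sub_measure (~: S))%E
  (@merge_pair S @^-1` tuple_box A)); first by [].
pose AS (k : 'I_#|S|) := A (enum_val k).
pose AC (k : 'I_#|~: S|) := A (enum_val k).
have -> : @merge_pair S @^-1` tuple_box A = tuple_box AS `*` tuple_box AC.
  rewrite predeqE => -[w z]; split=> [/= wzA|[/= wA zA] j].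
    split=> k /=; first by have := wzA (enum_val k); rewrite tnth_merge_in.
    by have := wzA (enum_val k); rewrite tnth_merge_out.
  have [[k ->]|[k ->]] := ord_in_or_out S j.
    by rewrite tnth_merge_in; exact: wA.
  by rewrite tnth_merge_out; exact: zA.
rewrite product_measure1E; [|by apply: measurable_tuple_box => k; exact: mA..].
rewrite [X in (X * _)%E]tuple_measure_box; last by move=> k; exact: mA.
rewrite [X in (_ * X)%E]tuple_measure_box; last by move=> k; exact: mA.
rewrite [RHS](bigID (mem S))/=; congr (_ * _)%E; first by rewrite [RHS]big_enum_val.
transitivity (\prod_(i in ~: S) nu i (A i))%E; first by rewrite [RHS]big_enum_val.
by apply: eq_bigl => i; rewrite finset.in_setC.
Qed.

End splitting.

(** * Marginal densities and the conditional Markov inequality *)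

Section marginalization.
Context {R : realType} {n : nat}.
Variable nu : 'I_n -> {sigma_finite_measure set R -> \bar R}.
Variable S : {set 'I_n}.

Section one_density.
Variable f : n.-tuple R -> R.
Hypotheses (mf : measurable_fun setT f) (f0 : forall y, 0 <= f y).

Let mfmerge : measurable_fun setT
  (EFin \o (f \o @merge_pair R n S)).
Proof.
apply/measurable_EFinP.
by apply: measurableT_comp => //; exact: measurable_merge_pair.
Qed.

Lemma measurable_marginal :
  measurable_fun setT (marginal nu f : #|S|.-tuple R -> \bar R).
Proof.
apply: (measurable_fun_fubini_tonelli_F (m2 := sub_measure nu (~: S)) _ mfmerge).
by move=> p; rewrite lee_fin f0.
Qed.

Lemma marginal_ge0 (w : #|S|.-tuple R) : (0 <= marginal nu f w)%E.
Proof. by apply: integral_ge0 => z _; rewrite lee_fin. Qed.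

(** Integrating out the coordinates outside [S] does not affect an event that
    depends on the coordinates in [S] only. *)
Lemma integral_marginal (B : set (#|S|.-tuple R)) : measurable B ->
  (\int[tuple_measure nu]_(y in subtuple S @^-1` B) (f y)%:E =
   \int[sub_measure nu S]_(w in B) marginal nu f w)%E.
Proof.
move=> mB; rewrite integral_mkcond [RHS]integral_mkcond.
set h := (fun y : n.-tuple R => (f y)%:E) \_ (subtuple S @^-1` B).
have mSB : measurable (subtuple S @^-1` B : set (n.-tuple R)).
  by rewrite -[X in measurable X]setTI; exact: measurable_subtuple.
have mh : measurable_fun setT h.
  by apply/(measurable_restrictT _ _).1 => //; apply/measurable_funTS/measurable_EFinP.
have h0 y : (0 <= h y)%E by apply: erestrict_ge0 => ? _; rewrite lee_fin.
have mmp := @measurable_merge_pair R n S.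
transitivity (\int[pushforward (sub_measure nu S \x sub_measure nu (~: S))%E
                    (@merge_pair R n S)]_y h y)%E.
  by apply: eq_measure_integral => A mA _; exact: tuple_measure_split.
rewrite ge0_integral_pushforward// preimage_setT.
rewrite fubini_tonelli1; last 2 first.
- by apply: measurableT_comp.
- by move=> p; exact: h0.
apply: eq_integral => w _; rewrite /fubini_F/= /h !patchE.
case: ifPn => wB.
  apply: eq_integral => z _; rewrite patchE ifT// inE /= /merge_pair/=.
  by rewrite subtuple_merge -inE.
apply: integral0_eq => z _; rewrite patchE ifF//; apply/negbTE; apply: contra wB.
by rewrite !inE /= /merge_pair/= subtuple_merge.
Qed.

End one_density.

(** Where [f / g > eta] one has [g <= f / eta], so the [g]-measure of the event
    is at most [1 / eta] times its [f]-measure, hence at most [1 / eta] times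
    the integral of the marginal of [f] where it is below [c] times that of
    [g]; the latter marginal integrates to 1.  The condition on the marginals
    is a product, not a quotient, because quotients of extended reals carry
    conventions for 0 and infinity. *)
Lemma likelihood_ratio_tail (g f : n.-tuple R -> R) (eta c : R) :
  is_density (tuple_measure nu) f -> is_density (tuple_measure nu) g ->
  0 < eta -> 0 <= c ->
  let A := [set y | eta < f y / g y] `&`
     subtuple S @^-1` [set w | (marginal nu f w <= c%:E * marginal nu g w)%E] in
  measurable A /\
  (\int[tuple_measure nu]_(y in A) (g y)%:E <= (c / eta)%:E)%E.
Proof.
move=> [mf f0 f1] [mg g0 g1] eta0 c0.
set B := [set w : #|S|.-tuple R | _].
move=> A.
have mB : measurable B.
  rewrite -[B]setTI; apply: measurable_lee => //; first exact: (measurable_marginal mf f0).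
  by apply: measurable_funeM; exact: (measurable_marginal mg g0).
have mSB : measurable (subtuple S @^-1` B : set (n.-tuple R)).
  by rewrite -[X in measurable X]setTI; exact: measurable_subtuple.
have g_gt0 y : eta < f y / g y -> 0 < g y.
  move=> fg; rewrite lt_neqAle g0 andbT; apply/eqP => gy0; move: fg.
  by rewrite -gy0 invr0 mulr0 ltNge ltW.
have etafg y : eta < f y / g y -> g y <= eta^-1 * f y.
  by move=> fg; rewrite ler_pdivlMl// -ler_pdivlMr ?g_gt0// ltW.
have AE : [set y | eta < f y / g y] =
    [set y | eta * g y < f y] `&` [set y | 0 < g y].
  rewrite predeqE => y; split=> /= [fg|[? gy0]]; last by rewrite ltr_pdivlMr.
  by rewrite -ltr_pdivlMr ?g_gt0.
have mlt (a b : n.-tuple R -> R) : measurable_fun setT a ->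
    measurable_fun setT b -> measurable [set y | a y < b y].
  move=> ma mb; under eq_set => y do rewrite -lte_fin.
  by rewrite -[X in measurable X]setTI; apply: measurable_lte => //;
    exact/measurable_EFinP.
have mA : measurable A.
  apply: measurableI => //; rewrite AE.
  by apply: measurableI; apply: mlt => //; exact: measurable_funM.
split => //.
apply: (@le_trans _ _ (\int[tuple_measure nu]_(y in A) (eta^-1%:E * (f y)%:E))%E).
  apply: ge0_le_integral => //.
  - by move=> y _; rewrite lee_fin.
  - by apply/measurable_EFinP; exact: measurable_funTS.
  - by apply: measurable_funeM; apply/measurable_EFinP; exact: measurable_funTS.
  - by move=> y [/etafg + _]; rewrite -EFinM lee_fin.
apply: (@le_trans _ _ (\int[tuple_measure nu]_(y in subtuple S @^-1` B) (eta^-1%:E * (f y)%:E))%E).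
  apply: ge0_subset_integral => //.
  - by apply: measurable_funeM; apply/measurable_EFinP; exact: measurable_funTS.
  - by move=> y _; rewrite -EFinM lee_fin mulr_ge0// invr_ge0 ltW.
  - by move=> y [].
rewrite ge0_integralZl_EFin//; last 3 first.
  - by move=> y _; rewrite lee_fin.
  - by apply/measurable_EFinP; exact: measurable_funTS.
  - by rewrite invr_ge0 ltW.
rewrite [c / _]mulrC EFinM; apply: lee_wpmul2l.
  by rewrite lee_fin invr_ge0 ltW.
rewrite integral_marginal//.
have mg' := measurable_marginal mg g0.
apply: (@le_trans _ _ (\int[sub_measure nu S]_(w in B) (c%:E * marginal nu g w))%E).
  apply: ge0_le_integral => //.
  - by move=> w _; exact: marginal_ge0.
  - by apply: measurable_funTS; exact: (measurable_marginal mf f0).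
  - by apply: measurable_funTS; exact: measurable_funeM.
rewrite ge0_integralZl_EFin//; last 2 first.
  - by move=> w _; exact: marginal_ge0.
  - exact: measurable_funTS.
rewrite -[leRHS]mule1; apply: lee_wpmul2l; first by rewrite lee_fin.
rewrite -[leRHS]g1 -integral_marginal//; apply: ge0_subset_integral => //.
- exact/measurable_EFinP.
- by move=> y _; rewrite lee_fin.
Qed.

End marginalization.

(** * Outer probabilities of the exceptional events *)

Section outer_measure_bounds.
Context {d} {T : measurableType d} {R : realType} (P : probability T R).

Lemma outer_measure_bigcup_ord M (E : 'I_M -> set T) (c : R) :
  (forall k, ((P^*)%mu (E k) <= c%:E)%E) ->
  ((P^*)%mu (\bigcup_k E k) <= (M%:R * c)%:E)%E.
Proof.
elim: M E => [|M IHM] E EP.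
  by rewrite (_ : \bigcup_k E k = set0) ?outer_measure0 ?mul0r// predeqE => w; split=> // -[[]].
rewrite (_ : \bigcup_k E k = E ord0 `|` \bigcup_k E (lift ord0 k)); last first.
  rewrite predeqE => w; split=> [[k _ Ek]|[E0|[k _ Ek]]]; last 2 first.
  - by exists ord0.
  - by exists (lift ord0 k).
  case: (unliftP ord0 k) Ek => [j|] -> Ek; last by left.
  by right; exists j.
apply: (le_trans (outer_measureU2 _ _ _)).
rewrite -natr1 mulrDl mul1r addrC EFinD; apply: leeD; last exact: EP.
by apply: IHM => k; exact: EP.
Qed.

Lemma outer_measure_ae (Q : set T) : {ae P, forall w, Q w} -> (P^*)%mu (~` Q) = 0%E.
Proof.
move=> [N [mN N0 QN]]; apply/eqP; rewrite eq_le outer_measure_ge0 andbT.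
by rewrite -N0 -(measurable_mu_extE _ mN); exact: le_outer_measure.
Qed.

End outer_measure_bounds.

(** Division by 0 yields infinity unless the numerator is 0, and division by
    infinity yields 0; [0 < c] makes the product infinite in the second case. *)
Lemma le_mul_of_div_le {R : realType} (x y : \bar R) (c : R) :
  (0 <= x)%E -> (0 <= y)%E -> 0 < c -> (x / y <= c%:E -> x <= c%:E * y)%E.
Proof.
move=> x0 y0 c0; move: y y0 => [y| |]// y0.
- have [->|yn0] := eqVneq y 0.
    rewrite inve0 mule0; have [->|xn0] := eqVneq x 0%E; first by [].
    by rewrite gt0_muley ?lt_neqAle 1?eq_sym ?xn0//.
  have {}y0 : 0 < y by rewrite lt_neqAle eq_sym yn0 -lee_fin.
  rewrite inver (negbTE yn0) => xy.
  by rewrite -lee_pdivrMr// .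
- by move=> _; rewrite gt0_muley ?lte_fin// leey.
Qed.

(** Since [(a - b) ^ 2 <= 2 * (c - a) ^ 2 + 2 * (c - b) ^ 2] coordinatewise,
    this constant follows without Minkowski's inequality. *)
Lemma enorm_ball_diam {R : realType} {d} (c t t' : 'rV[R]_d) (r : R) :
  eball c r t -> eball c r t' -> enorm (t - t') <= 2 * r.
Proof.
rewrite /eball /enorm /= => tr t'r.
have r0 : 0 < r by exact: le_lt_trans tr.
have sq (x : 'rV[R]_d) : Num.sqrt (\sum_(j < d) x ord0 j ^+ 2) < r ->
    \sum_(j < d) x ord0 j ^+ 2 <= r ^+ 2.
  move=> xr; rewrite -[leLHS]sqr_sqrtr; last by apply: sumr_ge0 => j _; exact: sqr_ge0.
  by rewrite ler_sqr ?nnegrE// ?ltW.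
have {tr}tr := sq _ tr; have {t'r}t'r := sq _ t'r.
rewrite -[leRHS]ger0_norm ?mulr_ge0 ?(ltW r0)// -sqrtr_sqr; apply: ler_wsqrtr.
apply: (@le_trans _ _ (2 * \sum_(j < d) (c - t) ord0 j ^+ 2 +
                       2 * \sum_(j < d) (c - t') ord0 j ^+ 2)).
  rewrite !mulr_sumr -big_split/=; apply: ler_sum => j _; rewrite !mxE.
  rewrite -subr_ge0 (_ : _ - _ = (2 * c ord0 j - t ord0 j - t' ord0 j) ^+ 2); last by ring.
  exact: sqr_ge0.
by rewrite exprMn; lra.
Qed.

Section lipschitz.
Context {R : realType} {p n : nat}.
Variables (f : 'rV[R]_p -> n.-tuple R -> R) (theta0 : 'rV[R]_p) (y : n.-tuple R).

(** The logarithm of the ratio is at most -2 at [t0] and moves by at most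
    [2 * delta * |K| <= 1] between the two points.  An infinite value at either
    point is excluded because the difference would be infinite. *)
Lemma lik_lt1_of_lipschitz (c t t0 : 'rV[R]_p) (K delta : R) :
  eball c delta t -> eball c delta t0 -> `|K * delta| <= 2^-1 ->
  (`|loglik f theta0 y t - loglik f theta0 y t0| <= (K * enorm (t - t0))%:E)%E ->
  lik f theta0 y t0 <= expR (- 2) -> lik f theta0 y t < 1.
Proof.
move=> ct ct0 Kd lip t0small.
have d0 : 0 < delta by exact: le_lt_trans (sqrtr_ge0 _) ct.
have {}lip : (`|loglik f theta0 y t - loglik f theta0 y t0| <= 1%:E)%E.
  apply: (le_trans lip); rewrite lee_fin.
  apply: (@le_trans _ _ (`|K| * (2 * delta))).
    apply: (@le_trans _ _ (`|K| * enorm (t - t0))).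
      by apply: ler_wpM2r; [exact: sqrtr_ge0|exact: ler_norm].
    by apply: ler_wpM2l => //; exact: enorm_ball_diam ct ct0.
  by move: Kd; rewrite normrM (gtr0_norm d0); lra.
have l0 : (loglik f theta0 y t0 <= (- 2)%:E)%E.
  rewrite /loglik /lne; case: ifPn => [_|]; first exact: leNye.
  rewrite -ltNge => lik0; rewrite lee_fin -[leRHS]expRK ler_ln ?posrE ?expR_gt0//.
rewrite -lte_fin -lne_lt0 -/(loglik f theta0 y t).
move: lip l0; case: (loglik f theta0 y t) => [l| |]; case: (loglik f theta0 y t0) => [l0| |]//=.
by rewrite !lee_fin lte_fin ler_norml; lra.
Qed.

End lipschitz.

Section one_piece.
Context {R : realType} {d : nat} {dO : measure_display}.
Context {Omega : measurableType dO} {P : probability Omega R}.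
Variable Y : forall n, 'I_n -> {RV P >-> R}.
Variable nu : forall n, 'I_n -> {sigma_finite_measure set R -> \bar R}.
Variable theta0 : 'rV[R]_d.
Variable f : forall n, 'rV[R]_d -> n.-tuple R -> R.
Variable n : nat.

Lemma measurable_sample : measurable_fun setT (sample Y n).
Proof.
apply/measurable_fun_tnthP => i.
rewrite (_ : _ \o _ = (Y i : Omega -> R)); first by [].
by apply/funext => w /=; rewrite tnth_mktuple.
Qed.

Hypothesis density0 : is_density (tuple_measure (@nu n)) (@f n theta0).
Hypothesis law : forall A : set (n.-tuple R), measurable A ->
    P (sample Y n @^-1` A) =
      (\int[tuple_measure (@nu n)]_(y in A) (@f n theta0 y)%:E)%E.

(** The bound on the marginals is multiplicative for a positive constant only,
    so it is used with [c + e * eta] for arbitrarily small [e > 0]; this also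
    covers [c = 0]. *)
Lemma lik_tail_bound (S : {set 'I_n}) t (eta c : R) :
  is_density (tuple_measure (@nu n)) (@f n t) -> 0 < eta -> 0 <= c ->
  ((P^*)%mu [set w | (eta < lik (@f n) theta0 (sample Y n w) t)%R /\
     (sublik (@nu n) (@f n) theta0 (subtuple S (sample Y n w)) t <= c%:E)%E]
   <= (c / eta)%:E)%E.
Proof.
move=> dt eta0 c0; apply/lee_addgt0Pr => e e0.
have c'0 : 0 < c + e * eta by rewrite ltr_wpDl// mulr_gt0.
have /= [] := likelihood_ratio_tail S dt density0 eta0 (ltW c'0).
set A := (X in measurable X) => mA intA.
have mYA : measurable (sample Y n @^-1` A).
  by rewrite -[X in measurable X]setTI; exact: measurable_sample.
apply: (@le_trans _ _ ((P^*)%mu (sample Y n @^-1` A))).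
  apply: le_outer_measure => w [likw subw]; split => //=.
  have [[_ ft0 _] [_ f00 _]] := (dt, density0).
  apply: le_mul_of_div_le => //; [exact: marginal_ge0..|].
  by apply: (le_trans subw); rewrite lee_fin lerDl mulr_ge0// ltW.
rewrite [leLHS]measurable_mu_extE//; apply: (le_trans _ (_ : ((c + e * eta) / eta)%:E <= _)%E).
  by move: intA; rewrite -(law mA).
by rewrite -EFinD lee_fin mulrDl mulfK// gt_eqF.
Qed.

(** Off the three exceptional events and the null set of the Lipschitz
    condition, every chosen point has ratio at most [exp (-2)], and the
    Lipschitz condition carries this over to [A]. *)
Lemma lik_ge1_bound (A : set 'rV[R]_d) (S : forall n, {set 'I_n})
    (K : {RV P >-> R}) (M : nat) (delta c : R) :
  (forall t, A t -> is_density (tuple_measure (@nu n)) (@f n t)) ->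
  covered_by_balls A M delta -> lipschitz_loglik Y f theta0 A n K -> 0 <= c ->
  ((P^*)%mu [set w | exists2 t, A t & (1 <= lik (@f n) theta0 (sample Y n w) t)%R] <=
   (P^*)%mu [set w | (2^-1%:E < `|(K w * delta)%:E|)%E] +
   (P^*)%mu [set w | (c%:E < `|sup_lik_of Y nu f theta0 A S n w|)%E] +
   (M%:R * (c / expR (- 2)))%:E)%E.
Proof.
move=> dA [x Ax] lip c0.
(* [theta0] is a dummy choice for the balls that miss [A]; [E k] below contains
   the requirement [A (t k)], so such balls contribute nothing. *)
have /choice[t tP] : forall k : 'I_M, exists t,
    (A `&` eball (x k) delta) !=set0 -> (A `&` eball (x k) delta) t.
  move=> k; have [[t At]|nA] := pselect ((A `&` eball (x k) delta) !=set0).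
    by exists t.
  by exists theta0.
pose N := ~` [set w | forall t t', A t -> A t' ->
  (`|loglik (@f n) theta0 (sample Y n w) t - loglik (@f n) theta0 (sample Y n w) t'|
      <= (K w * enorm (t - t'))%:E)%E].
pose E k := [set w | A (t k) /\ (expR (-2) < lik (@f n) theta0 (sample Y n w) (t k) /\
     (sublik (@nu n) (@f n) theta0 (subtuple (S n) (sample Y n w)) (t k) <= c%:E)%E)].
set E1 := [set w | (2^-1%:E < _)%E].
set E2 := [set w | (c%:E < _)%E].
apply: (@le_trans _ _ ((P^*)%mu (N `|` (E1 `|` E2 `|` \bigcup_k E k)))).
  apply: le_outer_measure => w [s As liks].
  apply: contrapT => /not_orP[/contrapT wN /not_orP[/not_orP[nE1 nE2] nE]].
  have [k _ sk] := Ax _ As.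
  have [Atk tk] : (A `&` eball (x k) delta) (t k) by apply: tP; exists s.
  move: liks; apply/negP; rewrite -ltNge.
  apply: (lik_lt1_of_lipschitz sk tk _ (wN _ _ As Atk)).
    by move/negP : nE1; rewrite -leNgt lee_fin.
  rewrite leNgt; apply/negP => likt; apply: nE; exists k => //; split => //; split => //.
  move/negP : nE2; rewrite -leNgt; apply: le_trans.
  rewrite /sup_lik_of /sup_sublik gee0_abs le_max ?lexx//; apply/orP; right.
  by apply: ereal_sup_ubound; exists (t k).
apply: (le_trans (outer_measureU2 _ _ _)).
rewrite [X in (X + _)%E](outer_measure_ae lip) add0e.
apply: (le_trans (outer_measureU2 _ _ _)); apply: leeD.
  exact: outer_measureU2.
apply: outer_measure_bigcup_ord => k.
have [Atk|nAtk] := pselect (A (t k)).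
  apply: le_trans (lik_tail_bound (S n) (dA _ Atk) (expR_gt0 (-2)) c0).
  by apply: le_outer_measure => w [].
rewrite (_ : E k = set0) ?outer_measure0 ?lee_fin ?divr_ge0 ?expR_ge0//.
by rewrite predeqE => w; split=> // -[].
Qed.

End one_piece.

(** * Interior maxima and the likelihood equation *)

Section interior_maximum.
Context {R : realType} {d : nat}.
Implicit Types (x t v : 'rV[R]_d) (h : 'rV[R]_d -> R) (e : R).

Lemma enorm_continuous : continuous (@enorm R d).
Proof.
move=> x; apply: (continuous_comp _ (@sqrt_continuous R _)).
have cvg_coord (j : 'I_d) : (t ord0 j ^+ 2 : R) @[t --> x] --> x ord0 j ^+ 2.
  exact: (cvg_comp _ _ (@coord_continuous R _ _ ord0 j x) (@exprn_continuous R 2 _)).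
have := @cvg_big _ _ _ 0 xpredT (@add_continuous R) _ _ (index_enum 'I_d) _ _
  (nbhs_filter x) (fun j _ => cvg_coord j).
exact.
Qed.

Lemma eball_open t e : open (eball t e).
Proof.
rewrite (_ : eball t e = (fun t' => enorm (t - t')) @^-1` [set r | r < e])//.
apply: open_comp; last exact: open_lt.
move=> t' _; apply: (@cvg_comp _ _ _ (fun s => t - s) enorm).
  apply: (@cvgB _ _ _ (nbhs t') _ (cst t) id); [exact: cvg_cst|exact: cvg_id].
exact: enorm_continuous.
Qed.

Lemma eball_center t e : 0 < e -> eball t e t.
Proof.
move=> e0; rewrite /eball /= subrr /enorm big1 ?sqrtr0// => j _.
by rewrite mxE expr0n.
Qed.

(** [ball] is the max-norm ball, which contains the Euclidean one. *)
Lemma sub_eball_ball t e : eball t e `<=` ball t e.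
Proof.
move=> t' tt'; have e0 : 0 < e by exact: le_lt_trans (sqrtr_ge0 _) tt'.
rewrite mx_norm_ball /ball_ /=; change (mx_norm (t - t') < e); rewrite mx_normrE.
apply/bigmax_ltP; split => // -[i j] _ /=; rewrite (ord1 i).
apply: le_lt_trans tt'; rewrite -sqrtr_sqr; apply: ler_wsqrtr.
by rewrite (bigD1 j)//= lerDl; apply: sumr_ge0 => k _; exact: sqr_ge0.
Qed.

Lemma sub_closure_eball t e : closure (eball t e) `<=` closed_ball t e.
Proof. exact: closure_subset (@sub_eball_ball t e). Qed.

Lemma compact_closure_eball t e : 0 < e -> compact (closure (eball t e)).
Proof.
move=> e0; apply: bounded_closed_compact; last exact: closed_closure.
exists (`|t| + e); split; first by rewrite num_real.
move=> r tr t' /sub_closure_eball; rewrite closed_ballE// /closed_ball_ /= => tt'.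
apply: le_trans (ltW tr); rewrite -[t'](subrK t) addrC.
by apply: (le_trans (ler_normD _ _)); rewrite lerD2l distrC.
Qed.

Lemma derive_le0_at_local_max h x v : derivable h x v ->
  (\forall t \near x, h t <= h x) -> 'D_v h x <= 0.
Proof.
move=> dh hmax; rewrite /derive cvg_at_rightE//; apply: limr_le.
  rewrite -(cvg_at_rightE (fun s : R => s^-1 *: ((h \o shift x) _ - h x))) //.
  apply: cvg_trans dh; apply: cvg_app.
  move=> A [e egt0 Ae]; exists e => // s xe xgt0; apply: Ae => //.
  exact/lt0r_neq0.
near=> s; apply: mulr_ge0_le0.
  by rewrite invr_ge0; apply: ltW; near: s; exists 1 => /=.
rewrite subr_le0 /=; near: s.
have shiftx : (s *: v + x) @[s --> (0 : R)^'+] --> 0 *: v + x.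
  apply: cvg_at_right_filter; apply: cvgD; last exact: cvg_cst.
  exact: (@scalel_continuous R _ v 0).
have hmax0 : \forall t \near 0 *: v + x, h t <= h x by rewrite scale0r add0r.
exact: shiftx hmax0.
Unshelve. all: by end_near. Qed.

(** The derivatives along [v] and [- v] are both nonpositive, and differ by a
    sign. *)
Lemma derive_eq0_at_local_max h x v : differentiable h x ->
  (\forall t \near x, h t <= h x) -> 'D_v h x = 0.
Proof.
move=> dh hmax; have dv w : derivable h x w by exact: diff_derivable.
apply/eqP; rewrite eq_le derive_le0_at_local_max//=.
by have := derive_le0_at_local_max (dv (- v)) hmax; rewrite !deriveE// linearN oppr_le0.
Qed.

End interior_maximum.

(** For [r <= 0], the value of [lne] is infinite, with finite part 0, and [ln]
    is 0 too; so the real-valued log-likelihood is [ln] of the ratio at every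
    parameter. *)
Lemma fine_lne {R : realType} (r : R) : fine (lne r%:E) = ln r.
Proof. by rewrite /lne; case: ifPn => // r0; rewrite ln0. Qed.

Section roots.
Context {R : realType} {p n : nat}.
Variables (f : 'rV[R]_p -> n.-tuple R -> R) (theta0 : 'rV[R]_p) (y : n.-tuple R).
Let L := lik f theta0 y.

Lemma likelihood_root_of_max theta : differentiable L theta -> 0 < L theta ->
  (\forall t \near theta, L t <= L theta) -> likelihood_root f theta0 y theta.
Proof.
move=> dL L0 Lmax.
have Lpos : \forall t \near theta, 0 < L t.
  have cL : L t @[t --> theta] --> L theta := differentiable_continuous dL.
  exact: cvgr_gt cL _ L0.
have llE : fine \o loglik f theta0 y = @ln R \o L.
  by apply/funext => t; rewrite /= /loglik fine_lne.
have dll : differentiable (@ln R \o L) theta.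
  apply: differentiable_comp => //; apply/derivable1_diffP.
  by apply: ex_derive; exact: is_derive1_ln.
split.
- by apply: filterS Lpos => t Lt; rewrite /loglik lne_EFin.
- by rewrite llE.
rewrite llE; apply/rowP => j; rewrite !mxE; apply: derive_eq0_at_local_max => //.
apply: filterS2 Lpos Lmax => t Lt LtL /=.
by rewrite ler_ln.
Qed.

(** A maximizer over the closed ball has ratio at least that of the center,
    which is 1, so it avoids the sphere. *)
Lemma likelihood_root_in_ball (Theta : set 'rV[R]_p) (e : R) :
  0 < e -> closure (eball theta0 e) `<=` Theta ->
  (forall t, closure (eball theta0 e) t -> differentiable L t) ->
  L theta0 = 1 ->
  (forall t, closure (eball theta0 e) t -> ~ eball theta0 e t -> L t < 1) ->
  exists theta, [/\ eball theta0 e theta, local_maximizer Theta L theta &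
    likelihood_root f theta0 y theta].
Proof.
move=> e0 ballT dL L1 Lbd.
set B := closure (eball theta0 e).
have B0 : B theta0 by apply: subset_closure; exact: eball_center.
have contL : {within B, continuous L}.
  apply: continuous_in_subspaceT => t; rewrite inE => Bt.
  exact: differentiable_continuous (dL _ Bt).
have [t /set_mem Bt tmax] := EVT_max_rV (ex_intro _ _ B0) (compact_closure_eball e0) contL.
have L1t : 1 <= L t by rewrite -L1; apply: tmax; rewrite inE.
have bt : eball theta0 e t.
  by apply: contrapT => nbt; have := Lbd _ Bt nbt; rewrite ltNge L1t.
have near_max : \forall s \near t, L s <= L t.
  have : \forall s \near t, eball theta0 e s.
    exact: open_nbhs_nbhs (conj (@eball_open _ _ theta0 e) bt).
  by apply: filterS => s bs; apply: tmax; rewrite inE; exact: subset_closure.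
exists t; split => //.
- split; first exact: ballT.
  by apply: cvg_within.
- by apply: likelihood_root_of_max => //; [exact: dL|exact: lt_le_trans L1t].
Qed.

End roots.

Lemma near_closure_eball_sub {R : realType} {d} (t : 'rV[R]_d) (U : set 'rV[R]_d) :
  nbhs t U -> \forall e \near (0:R)^'+, closure (eball t e) `<=` U.
Proof.
move=> /nbhs_ballP[r /= r0 rU]; near=> e.
apply: (subset_trans (@sub_closure_eball _ _ t e)).
apply: subset_trans rU; apply: closed_ball_subset.
- by near: e; exact: nbhs_right_gt.
- by near: e; exact: nbhs_right_lt.
Unshelve. all: by end_near. Qed.

(** * The consistency theorem *)

Lemma cvge0P {R : realType} (u : nat -> \bar R) : (forall n, (0 <= u n)%E) ->
  u n @[n --> \oo] --> 0%E <->
  forall eta : R, 0 < eta -> \forall n \near \oo, (u n <= eta%:E)%E.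
Proof.
move=> u0; split=> [/fine_cvgP[ufin /cvgr0Pnorm_le ule] eta /ule ueta|ule].
  apply: filterS2 ufin ueta => n unfin.
  by rewrite ger0_norm ?fine_ge0// -lee_fin fineK.
apply/fine_cvgP; split.
  apply: filterS (ule _ ltr01) => n un1.
  by rewrite ge0_fin_numE// (le_lt_trans un1)// ltry.
apply/cvgr0Pnorm_le => eta /ule; apply: filterS => n uneta.
rewrite /= ger0_norm ?fine_ge0// -lee_fin fineK//.
by rewrite ge0_fin_numE// (le_lt_trans uneta)// ltry.
Qed.

Lemma prob_density_eq0 {R : realType} {dO : measure_display}
    {Omega : measurableType dO} {P : probability Omega R}
    (Y : forall n, 'I_n -> {RV P >-> R}) n (m : {measure set (n.-tuple R) -> \bar R})
    (g : n.-tuple R -> R) :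
  measurable_fun setT g ->
  (forall A : set (n.-tuple R), measurable A ->
    P (sample Y n @^-1` A) = (\int[m]_(y in A) (g y)%:E)%E) ->
  (P^*)%mu [set w | g (sample Y n w) = 0] = 0%E.
Proof.
move=> mg law.
pose Z := [set y | g y = 0].
have mZ : measurable Z.
  by rewrite -[Z]setTI; exact: (mg measurableT _ (measurable_set1 0)).
have mYZ : measurable (sample Y n @^-1` Z).
  by rewrite -[X in measurable X]setTI; exact: measurable_sample.
rewrite [LHS](measurable_mu_extE _ mYZ) [LHS](law _ mZ).
by apply: integral0_eq => y ->.
Qed.

Theorem theorem2p4 (R : realType) (d : nat)
  (dO : measure_display) (Omega : measurableType dO) (P : probability Omega R)
  (Y : forall n, 'I_n -> {RV P >-> R})
  (nu : forall n, 'I_n -> {sigma_finite_measure set R -> \bar R})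
  (Theta : set 'rV[R]_d) (theta0 : 'rV[R]_d)
  (f : forall n, 'rV[R]_d -> n.-tuple R -> R) :
  (1 <= d)%N ->
  (forall n theta, (1 <= n)%N -> Theta theta ->
    is_density (tuple_measure (@nu n)) (f n theta)) ->
  (forall n (A : set (n.-tuple R)), (1 <= n)%N -> measurable A ->
    P (sample Y n @^-1` A) =
      (\int[tuple_measure (@nu n)]_(y in A) (f n theta0 y)%:E)%E) ->
  Theta° theta0 ->
  (exists2 U, nbhs theta0 U & forall n, (1 <= n)%N ->
    {ae P, forall w, forall theta, U theta ->
      differentiable (lik (f n) theta0 (sample Y n w)) theta}) ->
  (\forall e \near 0^'+, exists (s : nat) (A : 'I_s -> set 'rV[R]_d)
      (W : 'I_s -> forall n, {set 'I_n}) (a : nat -> 'I_s -> R)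
      (K : nat -> 'I_s -> {RV P >-> R})
      (M : nat -> 'I_s -> nat) (delta : nat -> 'I_s -> R),
    [/\ forall i, A i `<=` closure (eball theta0 e),
        closure (eball theta0 e) `&` ~` eball theta0 e `<=` \bigcup_i A i &
        forall i,
        [/\ #|W i n| @[n --> \oo] --> \oo,
            identified Y nu f theta0 (A i) (W i)
              /\ identification_rate Y nu f theta0 (A i) (W i) (a ^~ i),
            forall n, (1 <= n)%N ->
              lipschitz_loglik Y f theta0 (A i) n (K n i) &
            [/\ forall n, (1 <= n)%N ->
                  covered_by_balls (A i) (M n i) (delta n i),
                cvg_in_probability0 P (fun n w => (K n i w * delta n i)%:E) &
                (M n i)%:R * a n i @[n --> \oo] --> 0]]]) ->
  \forall e \near 0^'+, with_probability_tending_to_one P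
    (fun n => [set w | exists theta, [/\ eball theta0 e theta,
       local_maximizer Theta (lik (f n) theta0 (sample Y n w)) theta &
       likelihood_root (f n) theta0 (sample Y n w) theta]]).
Proof.
move=> _ dens law Theta0 [U U0 diffU] pieces.
have T0 : Theta theta0 by exact: nbhs_singleton Theta0.
apply: filterS3 (filterI (nbhs_right_gt 0) (near_closure_eball_sub Theta0))
  (near_closure_eball_sub U0) pieces
  => e [e0 ballT] ballU [s [A [W [a [K [M [delta [subA coverA cond]]]]]]]].
pose B n i := [set w | exists2 t, A i t & 1 <= lik (f n) theta0 (sample Y n w) t].
have B_small eta : 0 < eta ->
    \forall n \near \oo, forall i, ((P^*)%mu (B n i) <= eta%:E)%E.
  move=> eta0; apply: filter_forall => i.
  have [_ [_ rate] lip [cover Kd Ma]] := cond i.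
  have eta3 : 0 < eta / 3 by rewrite divr_gt0.
  have [C C0 rateC] := rate _ eta3.
  have half0 : 0 < 2^-1 :> R by [].
  have {}Kd := (cvge0P (fun n => outer_measure_ge0 _ _)).1 (Kd _ half0) _ eta3.
  have {}Ma : \forall n \near \oo,
      (M n i)%:R * (C * `|a n i| / expR (- 2)) <= eta / 3.
    have b0 : 0 < eta / 3 / (C / expR (- 2)) by rewrite !divr_gt0// expR_gt0.
    move/cvgr0Pnorm_le : Ma => /(_ _ b0); apply: filterS => n /=.
    rewrite normrM normr_nat ler_pdivlMr ?divr_gt0 ?expR_gt0//.
    by apply: le_trans; rewrite le_eqVlt; apply/orP; left; apply/eqP; ring.
  near=> n.
  have n1 : (1 <= n)%N by near: n; exact: nbhs_infty_ge.
  have dA t : A i t -> is_density (tuple_measure (@nu n)) (f n t).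
    by move=> At; apply: dens => //; apply: ballT; exact: subA At.
  have Ca0 : 0 <= C * `|a n i| by rewrite mulr_ge0// ltW.
  have := lik_ge1_bound (dens _ _ n1 T0) (fun X => law n X n1) (W i)
    dA (cover _ n1) (lip _ n1) Ca0.
  move/le_trans; apply.
  rewrite (_ : eta = eta / 3 + eta / 3 + eta / 3); last by field.
  rewrite !EFinD; apply: leeD; last by rewrite lee_fin; near: n.
  by apply: leeD; near: n.
apply/cvge0P => [n|eta eta0]; first exact: outer_measure_ge0.
(* Dividing by [s.+1] rather than [s] also covers an empty family of pieces. *)
have etas : 0 < eta / s.+1%:R by rewrite divr_gt0.
near=> n.
have n1 : (1 <= n)%N by near: n; exact: nbhs_infty_ge.
set E := [set w | _].
pose N := ~` [set w | forall theta, U theta ->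
  differentiable (lik (f n) theta0 (sample Y n w)) theta].
pose Z := [set w | f n theta0 (sample Y n w) = 0].
have sub : ~` E `<=` N `|` (Z `|` \bigcup_i B n i).
  move=> w nE; apply: contrapT => /not_orP[/contrapT wN /not_orP[wZ wB]].
  apply: nE; apply: likelihood_root_in_ball => //.
  - by move=> t /ballU; exact: wN.
  - by rewrite /lik divff//; apply/eqP.
  - move=> t clt nbt; have [i _ At] := coverA t (conj clt nbt).
    by rewrite ltNge; apply/negP => L1; apply: wB; exists i => //; exists t.
apply: (le_trans (le_outer_measure _ _ _ sub)).
apply: (le_trans (outer_measureU2 _ _ _)).
rewrite [X in (X + _)%E](outer_measure_ae (diffU _ n1)) add0e.
apply: (le_trans (outer_measureU2 _ _ _)).
have [mf0 _ _] := dens _ _ n1 T0.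
rewrite [X in (X + _)%E](prob_density_eq0 mf0 (fun X => law n X n1)) add0e.
apply: (@le_trans _ _ (s%:R * (eta / s.+1%:R))%:E).
  by apply: outer_measure_bigcup_ord; near: n; exact: B_small.
rewrite lee_fin mulrCA; apply: ler_piMr; first exact: ltW.
by rewrite ler_pdivrMr// mul1r ler_nat.
Unshelve. all: by end_near. Qed.
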